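(* Let $I^-_{FRT}\subset (V\otimes V^* )^{\otimes 2}$ be the $(-1)$-eigenspace (skew-symmetric part) of the involution $\tau_{FRT}$, and let $\mathcal{J}_{FRT}$ be the two-sided ideal of the tensor algebra $\mathrm{T}(V\otimes V^* )$ generated by $I^-_{FRT}$. Then the quotient algebra $\mathrm{T}(V\otimes V^* )/\mathcal{J}_{FRT}$ is isomorphic to the algebra $\mathcal{A}_{FRT}(\mathcal{M})$.
   Context: Scalars: $\mathbb{C}(q)$, $q$ a formal parameter; $\omega=q-q^{-1}$. $\mathcal{M}$ is the algebra of $n\times n$ matrices with matrix units $e^i_j$, $e^i_je^k_l=\delta^k_j e^i_l$. The Hecke matrix is $$S=q\sum_i e^i_i\otimes e^i_i+\sum_{i\ne j}e^i_j\otimes e^j_i+\omega\sum_{i<k}e^i_i\otimes e^k_k\in\mathcal{M}\otimes\mathcal{M}$$ (equivalently $S=q^{1/n}\sigma R$, with $\sigma=\sum_{i,j} e^i_j\otimes e^j_i$ the flip and $R=q^{-1/n}(q\sum_i e^i_i\otimes e^i_i+\sum_{i\neq j}e^i_i\otimes e^j_j+\omega\sum_{i<k}e^k_i\otimes e^i_k)$). $\mathcal{A}_{FRT}(\mathcal{M})$ is the associative unital algebra over $\mathbb{C}(q)$ generated by the entries $T^i_j$ of the matrix $T=\sum_{i,j} T^i_j\, e^j_i$ subject to $S T_1T_2=T_1T_2S$, where $T_1=T\otimes 1$, $T_2=1\otimes T$. $V$ has basis $e_1,\dots,e_n$ and $V^*$ the dual basis $f^1,\dots,f^n$. Define involutions: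 on $V\otimes V$, $\tau^r_{V\otimes V}(e_i\otimes e_i)=e_i\otimes e_i$ and, for $i\ne j$, $$\tau^r_{V\otimes V}(e_i\otimes e_j)=\mathrm{sign}(i-j)\tfrac{1-q^2}{1+q^2}\,e_i\otimes e_j+\tfrac{2q}{1+q^2}\,e_j\otimes e_i;$$ on $V^*\otimes V^*$, $\tau_{V^*\otimes V^*}(f^i\otimes f^i)=f^i\otimes f^i$ and, for $i\ne j$, $$\tau_{V^*\otimes V^*}(f^i\otimes f^j)=\mathrm{sign}(i-j)\tfrac{1-q^2}{1+q^2}\,f^i\otimes f^j+\tfrac{2q}{1+q^2}\,f^j\otimes f^i.$$ Let $\sigma_{V\otimes V^*}\colon V\otimes V^*\to V^*\otimes V$ be the ordinary flip. On $(V\otimes V^* )^{\otimes2}=V\otimes V^*\otimes V\otimes V^*$ put $$\tau_{FRT}=(\mathrm{id}\otimes\sigma_{V\otimes V^*}\otimes\mathrm{id})\circ(\tau^r_{V\otimes V}\otimes\tau_{V^*\otimes V^*})\circ(\mathrm{id}\otimes\sigma_{V\otimes V^*}^{-1}\otimes\mathrm{id}).$$ *)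

(* Defs.v *)
From HB Require Import structures.
From mathcomp Require Import all_boot all_order all_algebra.
From mathcomp Require Import generic_quotient ring_quotient fraction.
From mathcomp Require Import boolp reals complex mxtens.
From mathcomp Require Import finmap monalg.

Set Implicit Arguments.
Unset Strict Implicit.
Unset Printing Implicit Defensive.

Import GRing.Theory Num.Theory.

Local Open Scope ring_scope.
Local Open Scope quotient_scope.

HB.mixin Record isRightAbsorbing (A : nzRingType) (I : A -> bool) := {
  idealMl : forall a u : A, u \in I -> u * a \in I
}.

(* [Idealr] provides closure under left multiplication and 1 \notin I. *)
#[short(type="bideal")]
HB.structure Definition Bideal (A : nzRingType) :=
  {I of Idealr A I & isRightAbsorbing A I}.

Definition bquot (A : nzRingType) (I : bideal A) := Quotient.quot I.

Section RingQuotient.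
Variables (A : nzRingType) (I : bideal A).
Local Notation Q := (bquot I).

HB.instance Definition _ := GRing.Zmodule.on Q.
HB.instance Definition _ := ZmodQuotient.on Q.

Lemma bquot_eqP (x y : A) : reflect (\pi_Q x = \pi_Q y) (x - y \in I).
Proof. by rewrite Quotient.idealrBE; exact: eqP. Qed.

Lemma bquot_repr (x : A) : repr (\pi_Q x) - x \in I.
Proof. by apply/bquot_eqP; rewrite reprK. Qed.

Definition bquot_mul (x y : Q) : Q := \pi_Q (repr x * repr y).

Lemma bquot_mulE (x y : A) : bquot_mul (\pi_Q x) (\pi_Q y) = \pi_Q (x * y).
Proof.
apply/bquot_eqP.
have -> : repr (\pi_Q x) * repr (\pi_Q y) - x * y =
  (repr (\pi_Q x) - x) * repr (\pi_Q y) + x * (repr (\pi_Q y) - y).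
  by rewrite mulrBl mulrBr addrA addrNK.
by apply: rpredD; [apply: idealMl | apply: idealMr]; exact: bquot_repr.
Qed.

Lemma bquot_addE (x y : A) : \pi_Q x + \pi_Q y = \pi_Q (x + y).
Proof. by rewrite -pi_addr. Qed.

Lemma bquotW (P : Q -> Prop) : (forall x : A, P (\pi_Q x)) -> forall x, P x.
Proof. by move=> Ppi x; rewrite -[x]reprK. Qed.

Fact bquot_mulA : associative bquot_mul.
Proof.
elim/bquotW=> x; elim/bquotW=> y; elim/bquotW=> z.
by rewrite (bquot_mulE y) (bquot_mulE x y) (bquot_mulE x) bquot_mulE mulrA.
Qed.

Fact bquot_mul1 : left_id (\pi_Q 1) bquot_mul.
Proof. by elim/bquotW=> x; rewrite bquot_mulE mul1r. Qed.

Fact bquot_mulr1 : right_id (\pi_Q 1) bquot_mul.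
Proof. by elim/bquotW=> x; rewrite bquot_mulE mulr1. Qed.

Fact bquot_mulDl : left_distributive bquot_mul +%R.
Proof.
elim/bquotW=> x; elim/bquotW=> y; elim/bquotW=> z.
by rewrite bquot_addE !bquot_mulE bquot_addE mulrDl.
Qed.

Fact bquot_mulDr : right_distributive bquot_mul +%R.
Proof.
elim/bquotW=> x; elim/bquotW=> y; elim/bquotW=> z.
by rewrite bquot_addE !bquot_mulE bquot_addE mulrDr.
Qed.

Fact bquot_1neq0 : \pi_Q 1 != 0.
Proof.
apply/eqP => E; have /bquot_eqP : \pi_Q 1 = \pi_Q 0 by rewrite E pi_zeror.
by rewrite subr0 idealr1.
Qed.

HB.instance Definition _ := GRing.Zmodule_isNzRing.Build Q
  bquot_mulA bquot_mul1 bquot_mulr1 bquot_mulDl bquot_mulDr bquot_1neq0.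

Lemma bquot_piM (x y : A) : \pi_Q (x * y) = \pi_Q x * \pi_Q y.
Proof. by rewrite -bquot_mulE. Qed.

End RingQuotient.

Section AlgQuotient.
Variables (K : comNzRingType) (A : algType K) (I : bideal A).
Local Notation Q := (bquot I).

Definition bquot_scale (c : K) (x : Q) : Q := \pi_Q (c *: repr x).

Lemma bquot_scaleE c (x : A) : bquot_scale c (\pi_Q x) = \pi_Q (c *: x).
Proof.
apply/bquot_eqP; rewrite -scalerBr -[X in c *: X]mul1r scalerAl.
by apply: idealMr; exact: bquot_repr.
Qed.

Fact bquot_scaleA a b (x : Q) :
  bquot_scale a (bquot_scale b x) = bquot_scale (a * b) x.
Proof.
elim/bquotW: x => x.
by rewrite (bquot_scaleE b) (bquot_scaleE a) bquot_scaleE scalerA.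
Qed.

Fact bquot_scale1 : left_id 1 bquot_scale.
Proof. by elim/bquotW=> x; rewrite bquot_scaleE scale1r. Qed.

Fact bquot_scaleDr : right_distributive bquot_scale +%R.
Proof.
move=> c; elim/bquotW=> x; elim/bquotW=> y.
by rewrite bquot_addE !bquot_scaleE bquot_addE scalerDr.
Qed.

Fact bquot_scaleDl (x : Q) : {morph bquot_scale^~ x : a b / a + b}.
Proof.
move=> a b; elim/bquotW: x => x.
by rewrite !bquot_scaleE bquot_addE scalerDl.
Qed.

HB.instance Definition _ := GRing.Zmodule_isLmodule.Build K Q
  bquot_scaleA bquot_scale1 bquot_scaleDr bquot_scaleDl.

Lemma bquot_piZ c (x : A) : \pi_Q (c *: x) = c *: \pi_Q x.
Proof. by rewrite -bquot_scaleE. Qed.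

Fact bquot_scalerAl (c : K) (x y : Q) : c *: (x * y) = (c *: x) * y.
Proof.
elim/bquotW: x => x; elim/bquotW: y => y.
by rewrite -bquot_piM -!bquot_piZ -bquot_piM scalerAl.
Qed.

Fact bquot_scalerAr (c : K) (x y : Q) : c *: (x * y) = x * (c *: y).
Proof.
elim/bquotW: x => x; elim/bquotW: y => y.
by rewrite -bquot_piM -!bquot_piZ -bquot_piM scalerAr.
Qed.

HB.instance Definition _ := GRing.Lmodule_isLalgebra.Build K Q bquot_scalerAl.
HB.instance Definition _ := GRing.Lalgebra_isAlgebra.Build K Q bquot_scalerAr.

End AlgQuotient.

Record two_sided_ideal (A : nzRingType) (I : A -> Prop) : Prop := {
  ideal_0 : I 0;
  ideal_B : forall x y, I x -> I y -> I (x - y);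
  ideal_M : forall a x b, I x -> I (a * x * b)
}.

Definition gen_ideal (A : nzRingType) (X : A -> Prop) : pred A := fun a =>
  `[< forall I : A -> Prop,
        two_sided_ideal I -> (forall x, X x -> I x) -> I a >].

Section GenIdeal.
Variables (A : nzRingType) (X : A -> Prop).

Fact gen_ideal_zmod : zmod_closed (gen_ideal X).
Proof.
split=> [|x y /asboolP Ix /asboolP Iy]; apply/asboolP => I idI XI.
  exact: ideal_0.
by apply: (ideal_B idI); [exact: Ix | exact: Iy].
Qed.

HB.instance Definition _ := GRing.isZmodClosed.Build A (gen_ideal X)
  gen_ideal_zmod.

Fact gen_ideal_mull (a u : A) : u \in gen_ideal X -> a * u \in gen_ideal X.
Proof.
move=> /asboolP Iu; apply/asboolP => I idI XI.
by rewrite -[a * u]mulr1; apply: (ideal_M idI); exact: Iu.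
Qed.

Fact gen_ideal_mulr (a u : A) : u \in gen_ideal X -> u * a \in gen_ideal X.
Proof.
move=> /asboolP Iu; apply/asboolP => I idI XI.
by rewrite -[u]mul1r; apply: (ideal_M idI); exact: Iu.
Qed.

End GenIdeal.

(* The free unital associative K-algebra on B: finite K-linear combinations of
   words over B, multiplied by concatenation.  It is also the tensor algebra of
   the K-vector space with basis B. *)
Definition free_alg (K : comNzRingType) (B : choiceType) :=
  {malg K[{fmonom B}]}.

Section FreeAlgebra.
Variables (K : comNzRingType) (B : choiceType).
Local Notation F := (free_alg K B).

HB.instance Definition _ := GRing.Lalgebra.on F.

Fact free_alg_scalerAr (c : K) (x y : F) : c *: (x * y) = x * (c *: y).
Proof.
have comm (z : F) : c *: z = z * (c%:MP : F).
  rewrite malgZ_def malgM_def fgmulgU.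
  by apply: eq_bigr => k _; rewrite mulm1 mulrC.
have scal (z : F) : c *: z = (c%:MP : F) * z by rewrite -mul_malgC.
by rewrite scalerAl [c *: x]comm -mulrA -scal.
Qed.

HB.instance Definition _ := GRing.Lalgebra_isAlgebra.Build K F
  free_alg_scalerAr.

Definition gen (b : B) : F := << fmu b >>.

(* The constant coefficient; used only to show that ideals are proper. *)
Definition free_aug : F -> K := @mcoeff {fmonom B} K mone.
HB.instance Definition _ := GRing.RMorphism.on free_aug.

Lemma gen_ideal_proper (X : F -> Prop) :
  (forall x, X x -> free_aug x = 0) ->
  1 \notin gen_ideal X /\ forall a, {in gen_ideal X, forall u, a * u \in gen_ideal X}.
Proof.
move=> X0; split=> [|a u uI]; last exact: gen_ideal_mull.
apply/negP => /asboolP /(_ (fun x : F => free_aug x = 0)) I1.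
have /eqP : free_aug 1 = 0.
  apply: I1 => //; split=> [|x y x0 y0|a x b x0].
  - exact: rmorph0.
  - by rewrite rmorphB /= x0 y0 subrr.
  - by rewrite !rmorphM /= x0 mulr0 mul0r.
by rewrite rmorph1 oner_eq0.
Qed.

Lemma free_augM (x y : F) : free_aug (x * y) = free_aug x * free_aug y.
Proof. exact: rmorphM. Qed.

Lemma free_aug_gen b : free_aug (gen b) = 0.
Proof. by rewrite /free_aug /gen mcoeffU fm1_eq1. Qed.

Section Lift.
Variables (A : algType K) (phi : B -> A).

Let scal (c : K) : A := c%:A.
Fact free_scal_zmod : zmod_morphism scal.
Proof. by move=> c d; rewrite /scal scalerBl. Qed.
Fact free_scal_monoid : monoid_morphism scal.
Proof.
by split=> [|c d]; rewrite /scal ?scale1r // -scalerAl mul1r scalerA.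
Qed.
HB.instance Definition _ := GRing.isZmodMorphism.Build K A scal free_scal_zmod.
HB.instance Definition _ :=
  GRing.isMonoidMorphism.Build K A scal free_scal_monoid.

Let mono (m : {fmonom B}) : A := \prod_(b <- (m : seq B)) phi b.
Fact free_mono_morphism : mmorphism mono.
Proof.
by split=> [m1 m2|]; rewrite /mono ?fmM ?big_cat // fm1 big_nil.
Qed.
HB.instance Definition _ := isMultiplicative.Build {fmonom B} A mono
  free_mono_morphism.

Definition free_lift : F -> A := @mmap {fmonom B} K A scal mono.

Fact free_lift_zmod : zmod_morphism free_lift.
Proof. exact: mmap_is_additive. Qed.
Fact free_lift_monoid : monoid_morphism free_lift.
Proof.
have [] := @commr_mmap_is_multiplicative _ _ _ scal mono _.
  by move=> g m m'; rewrite /GRing.comm /= /scal -scalerAl -scalerAr mulr1 mul1r.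
by [].
Qed.
Fact free_lift_scalable : scalable free_lift.
Proof.
move=> c x; rewrite /free_lift [LHS](@mmapZ _ _ _ scal mono).
by rewrite /= /scal -scalerAl mul1r.
Qed.
HB.instance Definition _ := GRing.isZmodMorphism.Build F A free_lift
  free_lift_zmod.
HB.instance Definition _ := GRing.isMonoidMorphism.Build F A free_lift
  free_lift_monoid.
HB.instance Definition _ := GRing.isScalable.Build K F A *:%R free_lift
  free_lift_scalable.

Lemma free_lift_gen b : free_lift (gen b) = phi b.
Proof. by rewrite /free_lift mmapU /= /mono fmU big_seq1 /scal scale1r mul1r. Qed.

Lemma free_lift_ex :
  exists g : {lrmorphism F -> A}, forall b, g (gen b) = phi b.
Proof. by exists free_lift => b; exact: free_lift_gen. Qed.

End Lift.

Lemma free_wordE (s : seq B) : << FMonom s >> = \prod_(b <- s) gen b :> F.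
Proof.
elim: s => [|b s IHs]; first by rewrite big_nil -fmoneE.
rewrite big_cons -IHs malgM_def fgmulUU mulr1; congr << _ >>.
by apply/eqP; rewrite fmP fmM fmU.
Qed.

Lemma free_lift_uniq (A : algType K) (g g' : {lrmorphism F -> A}) :
  (forall b, g' (gen b) = g (gen b)) -> g' =1 g.
Proof.
move=> gE x.
have -> : x = \sum_(k <- msupp x) (mcoeff k x) *: (<< k >> : F).
  rewrite {1}[x]monalgE; apply: eq_bigr => k _.
  by apply/malgP => l; rewrite mcoeffZ !mcoeffU mulrnAr mulr1.
rewrite !linear_sum; apply: eq_bigr => -[s] _.
rewrite !linearZ free_wordE !rmorph_prod; congr (_ *: _).
by apply: eq_bigr => b _; exact: gE.
Qed.

End FreeAlgebra.

(* The K-vector space with basis B; its tensor product with [vec K C] is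
   [vec K (B * C)], with basis e b (x) e c = e (b, c). *)
Notation vec K B := {ffun B -> K^o}.

Section Coordinates.
Variable K : fieldType.

Definition bv (B : finType) (b : B) : vec K B := [ffun x => (x == b)%:R].

Definition tens (B C : finType) (u : vec K B) (v : vec K C) :
  vec K (B * C)%type := [ffun p => u p.1 * v p.2].

Definition linext_fun (B C : finType) (f : B -> vec K C) (u : vec K B) :
  vec K C := \sum_b u b *: f b.

Fact linext_is_linear (B C : finType) (f : B -> vec K C) :
  linear (linext_fun f).
Proof.
move=> a u v; rewrite /linext_fun scaler_sumr -big_split /=.
by apply: eq_bigr => b _; rewrite !ffunE scalerDl scalerA.
Qed.

HB.instance Definition _ (B C : finType) (f : B -> vec K C) :=
  GRing.isLinear.Build K (vec K B) (vec K C) *:%R (linext_fun f)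
    (linext_is_linear f).

(* The linear map sending [bv b] to [f b]. *)
Definition linext (B C : finType) (f : B -> vec K C) :
  'Hom(vec K B, vec K C) := linfun (linext_fun f).

Lemma linextE (B C : finType) (f : B -> vec K C) b : linext f (bv b) = f b.
Proof.
rewrite lfunE /= /linext_fun (bigD1 b) //= big1 => [|c /negPf cb].
  by rewrite ffunE eqxx scale1r addr0.
by rewrite ffunE cb scale0r.
Qed.

Definition tens_map (B C B' C' : finType)
    (f : 'Hom(vec K B, vec K B')) (g : 'Hom(vec K C, vec K C')) :
  'Hom(vec K (B * C)%type, vec K (B' * C')%type) :=
  linext (fun p => tens (f (bv p.1)) (g (bv p.2))).

(* id (x) f (x) id on the four-fold product A (x) B (x) C (x) D, the factors
   being regrouped as (A (x) B) (x) (C (x) D). *)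
Definition id_tens_id (A B C B' C' D : finType)
    (f : 'Hom(vec K (B * C)%type, vec K (B' * C')%type)) :
  'Hom(vec K ((A * B) * (C * D))%type, vec K ((A * B') * (C' * D))%type) :=
  linext (fun p => [ffun r =>
    bv p.1.1 r.1.1 * f (bv (p.1.2, p.2.1)) (r.1.2, r.2.1) * bv p.2.2 r.2.2]).

Definition flip (B C : finType) :
  'Hom(vec K (B * C)%type, vec K (C * B)%type) :=
  linext (fun p => tens (bv p.2) (bv p.1)).

(* The tensor algebra of W = [vec K B] is [free_alg K B]; [deg1] and [deg2] embed
   W and W (x) W as the components of degree 1 and 2. *)
Definition deg1 (B : finType) (v : vec K B) : free_alg K B :=
  \sum_b (v b : K) *: gen K b.

Definition deg2 (B : finType) (x : vec K (B * B)%type) : free_alg K B :=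
  \sum_p (x p : K) *: (gen K p.1 * gen K p.2).

Lemma deg1_bv (B : finType) (b : B) : deg1 (bv b) = gen K b.
Proof.
rewrite /deg1 (bigD1 b) //= big1 => [|c /negPf cb].
  by rewrite ffunE eqxx scale1r addr0.
by rewrite ffunE cb scale0r.
Qed.

Lemma deg2_tens (B : finType) (u v : vec K B) :
  deg2 (tens u v) = deg1 u * deg1 v.
Proof.
rewrite /deg1 mulr_suml /deg2.
under [RHS]eq_bigr do rewrite mulr_sumr.
rewrite pair_bigA /=; apply: eq_bigr => p _.
by rewrite ffunE -scalerAl -scalerAr scalerA.
Qed.

Lemma free_alg_universal (B : finType) (A : algType K)
    (f : {linear vec K B -> A}) :
  exists2 g : {lrmorphism free_alg K B -> A},
    forall v, g (deg1 v) = f v &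
    forall g' : {lrmorphism free_alg K B -> A},
      (forall v, g' (deg1 v) = f v) -> g' =1 g.
Proof.
have [g gE] := free_lift_ex (fun b => f (bv b)).
have bvE (v : vec K B) : v = \sum_b v b *: bv b.
  apply/ffunP => c; rewrite sum_ffunE (bigD1 c) //= big1 => [|b /negPf bc].
    by rewrite !ffunE eqxx addr0 [RHS]mulr1.
  by rewrite !ffunE eq_sym bc [LHS]mulr0.
exists g => [v|g' g'E].
  rewrite {2}[v]bvE /deg1 !linear_sum; apply: eq_bigr => b _.
  by rewrite !linearZ; congr (_ *: _); exact: gE.
by apply: free_lift_uniq => b; rewrite gE -deg1_bv g'E.
Qed.

End Coordinates.

Section FRT.
Variables (K : fieldType) (q : K) (n : nat).

(* The matrix unit e^i_j: upper index for rows, lower index for columns. *)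
Local Notation E i j := (delta_mx i j : 'M[K]_n).

Definition hecke_mx : 'M[K]_(n * n) :=
  q *: (\sum_(i < n) E i i *t E i i)
  + \sum_(i < n) \sum_(j < n | j != i) E i j *t E j i
  + (q - q^-1) *: (\sum_(i < n) \sum_(k < n | (i < k)%N) E i i *t E k k).

(* The generator [gen K (i, j)] is T^i_j. *)
Local Notation F := (free_alg K ('I_n * 'I_n)%type).

Definition frt_mx : 'M[F]_n :=
  \sum_(i < n) \sum_(j < n) gen K (i, j) *: delta_mx j i.

Definition frt_rel : 'M[F]_(n * n) :=
  let S := map_mx (fun c : K => c%:A : F) hecke_mx in
  let T1 := frt_mx *t (1%:M : 'M[F]_n) in
  let T2 := (1%:M : 'M[F]_n) *t frt_mx in
  S *m T1 *m T2 - T1 *m T2 *m S.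

Definition frt_ideal : pred F :=
  gen_ideal (fun x => exists r c, x = frt_rel r c).

Fact frt_rel_aug r c : free_aug (frt_rel r c) = 0.
Proof.
have T0 : map_mx (@free_aug K _) frt_mx = 0.
  apply/matrixP=> i j; rewrite mxE summxE raddf_sum big1 ?mxE // => k _.
  rewrite summxE raddf_sum big1 // => l _.
  by rewrite mxE /= free_augM free_aug_gen mul0r.
have T10 : map_mx (@free_aug K _) (frt_mx *t (1%:M : 'M[F]_n)) = 0.
  by rewrite map_mxT T0 tens0mx.
have comm0 m (S T1 T2 : 'M[F]_m) : map_mx (@free_aug K _) T1 = 0 ->
    map_mx (@free_aug K _) (S *m T1 *m T2 - T1 *m T2 *m S) = 0.
  by move=> T1_0; rewrite map_mxB !map_mxM T1_0 !(mulmx0, mul0mx) subrr.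
have /matrixP/(_ r c) := comm0 _ (map_mx (fun c : K => c%:A : F) hecke_mx)
  _ ((1%:M : 'M[F]_n) *t frt_mx) T10.
by rewrite [LHS]mxE [RHS]mxE.
Qed.

HB.instance Definition _ := GRing.isZmodClosed.Build F frt_ideal
  (gen_ideal_zmod _).
Fact frt_ideal_proper :
  1 \notin frt_ideal /\ forall a, {in frt_ideal, forall u, a * u \in frt_ideal}.
Proof. by apply: gen_ideal_proper => _ [r [c ->]]; exact: frt_rel_aug. Qed.
HB.instance Definition _ := isProperIdeal.Build F frt_ideal frt_ideal_proper.
HB.instance Definition _ := isRightAbsorbing.Build F frt_ideal
  (@gen_ideal_mulr _ _).

Definition A_FRT := bquot frt_ideal.

(* V and V^* are both [vec K 'I_n], the basis vector [bv K i] being e_i in V and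
   f^i in V^*; V (x) V and V^* (x) V^* carry the same formula. *)
Definition tau_basis (p : 'I_n * 'I_n) : vec K ('I_n * 'I_n)%type :=
  let: (i, j) := p in
  if i == j then tens (bv K i) (bv K j) else
    ((Num.sg (i%:Z - j%:Z))%:~R * ((1 - q ^+ 2) / (1 + q ^+ 2)))
       *: tens (bv K i) (bv K j)
    + (2%:R * q / (1 + q ^+ 2)) *: tens (bv K j) (bv K i).

Definition tau_VV : 'End(vec K ('I_n * 'I_n)%type) := linext tau_basis.
Definition tau_dualVV : 'End(vec K ('I_n * 'I_n)%type) := linext tau_basis.

(* V (x) V^* -> V^* (x) V *)
Definition sigma_VVdual : 'Hom(vec K ('I_n * 'I_n)%type, vec K ('I_n * 'I_n)%type)
  := flip K 'I_n 'I_n.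

Definition tau_FRT :
    'End(vec K (('I_n * 'I_n) * ('I_n * 'I_n))%type) :=
  (id_tens_id 'I_n 'I_n sigma_VVdual
     \o (tens_map tau_VV tau_dualVV \o id_tens_id 'I_n 'I_n sigma_VVdual^-1))%VF.

(* The basis element (i, j) of V (x) V^* is e_i (x) f^j. *)
Definition skew_ideal : pred F :=
  gen_ideal (fun x => exists2 u, u \in passmx.leigenspace tau_FRT (-1) & x = deg2 u).

Fact skew_ideal_proper :
  1 \notin skew_ideal
  /\ forall a, {in skew_ideal, forall u, a * u \in skew_ideal}.
Proof.
apply: gen_ideal_proper => _ [u _ ->]; rewrite /deg2 raddf_sum big1 // => p _.
by rewrite -[_ * _]mul1r scalerAl /= !free_augM free_aug_gen mul0r mulr0.
Qed.

HB.instance Definition _ := GRing.isZmodClosed.Build F skew_ideal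
  (gen_ideal_zmod _).
HB.instance Definition _ := isProperIdeal.Build F skew_ideal skew_ideal_proper.
HB.instance Definition _ := isRightAbsorbing.Build F skew_ideal
  (@gen_ideal_mulr _ _).

Definition T_mod_skew := bquot skew_ideal.

End FRT.

(* C(q), with C = R[i] for a complete archimedean ordered field R. *)
Definition ratfun (R : realType) := {fraction {poly R[i]}}.
HB.instance Definition _ (R : realType) := GRing.Field.on (ratfun R).

Definition qvar (R : realType) : ratfun R := tofrac 'X.

(* Main.v *)
(* Put tau for the involution of V (x) V (and of V^* (x) V^* ), and let L and R
   be its actions on the V-factors and on the V^*-factors of (V (x) V^* )^(x)2.
   They are commuting involutions with L R = tau_FRT, so the (-1)-eigenspace of
   tau_FRT is the image of R - L.  On the other hand
   tau = (2 A - (q - q^-1)) / (q + q^-1) where A is the operator with matrix S,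
   so the image of a basis vector under R - L is a nonzero multiple of an entry
   of S T_1 T_2 - T_1 T_2 S.  Hence the two ideals of the tensor algebra are
   equal. *)
Require Import Defs.
From HB Require Import structures.
From mathcomp Require Import all_boot all_order all_algebra reals.
From mathcomp Require Import generic_quotient ring_quotient fraction.
From mathcomp Require Import complex mxtens ring.

Set Implicit Arguments.
Unset Strict Implicit.
Unset Printing Implicit Defensive.

Import GRing.Theory Num.Theory.
Local Open Scope ring_scope.
Local Open Scope quotient_scope.

(** * Maps between quotients of an algebra by nested ideals *)

Section QuotientMap.
Variables (K : comNzRingType) (A : algType K) (I J : bideal A).

(** The inclusion is an argument so that the morphism instances below can be attached to
    [bquot_map IJ]. *)
Definition bquot_map (_ : {subset I <= J}) (x : bquot I) : bquot J :=
  \pi_(bquot J) (repr x).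

Hypothesis IJ : {subset I <= J}.

Lemma bquot_map_pi x : bquot_map IJ (\pi_(bquot I) x) = \pi_(bquot J) x.
Proof. by apply/bquot_eqP/IJ/bquot_repr. Qed.

Fact bquot_map_zmod : zmod_morphism (bquot_map IJ).
Proof.
elim/bquotW=> x; elim/bquotW=> y.
by rewrite -[_ - _]pi_is_additive !bquot_map_pi pi_is_additive.
Qed.

Fact bquot_map_monoid : monoid_morphism (bquot_map IJ).
Proof.
split; first exact: bquot_map_pi.
elim/bquotW=> x; elim/bquotW=> y.
by rewrite -bquot_piM !bquot_map_pi bquot_piM.
Qed.

Fact bquot_map_scalable : scalable (bquot_map IJ).
Proof.
move=> c; elim/bquotW=> x.
by rewrite -bquot_piZ !bquot_map_pi bquot_piZ.
Qed.

HB.instance Definition _ :=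
  GRing.isZmodMorphism.Build (bquot I) (bquot J) (bquot_map IJ) bquot_map_zmod.
HB.instance Definition _ :=
  GRing.isMonoidMorphism.Build (bquot I) (bquot J) (bquot_map IJ)
    bquot_map_monoid.
HB.instance Definition _ :=
  GRing.isScalable.Build K (bquot I) (bquot J) *:%R (bquot_map IJ)
    bquot_map_scalable.

End QuotientMap.

Lemma bquot_mapK (K : comNzRingType) (A : algType K) (I J : bideal A)
    (IJ : {subset I <= J}) (JI : {subset J <= I}) :
  cancel (bquot_map IJ) (bquot_map JI).
Proof.
move=> x; elim/bquotW: x => x.
by rewrite (bquot_map_pi IJ) (bquot_map_pi JI).
Qed.

Lemma bquot_iso (K : comNzRingType) (A : algType K) (I J : bideal A) :
  I =i J -> exists f : {lrmorphism bquot I -> bquot J}, bijective f.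
Proof.
move=> eqIJ.
have IJ : {subset I <= J} by move=> x; rewrite eqIJ.
have JI : {subset J <= I} by move=> x; rewrite eqIJ.
by exists (bquot_map IJ); exists (bquot_map JI); exact: bquot_mapK.
Qed.

(** * Ideals generated by a set *)

Lemma gen_ideal_sub (A : nzRingType) (X Y : A -> Prop) :
  (forall x, X x -> x \in gen_ideal Y) -> {subset gen_ideal X <= gen_ideal Y}.
Proof.
(* Membership in [gen_ideal Y] is itself a two-sided ideal, hence one of the ideals intersected in
   [gen_ideal X]. *)
move=> XY a /boolp.asboolP /(_ (fun x => x \in gen_ideal Y)); apply=> //.
split=> [|x y|c x d xY].
- exact: rpred0.
- exact: rpredB.
- by apply: gen_ideal_mulr; apply: gen_ideal_mull.
Qed.

Lemma mem_gen_ideal (A : nzRingType) (X : A -> Prop) x :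
  X x -> x \in gen_ideal X.
Proof. by move=> Xx; apply/boolp.asboolP => I _; exact. Qed.

Lemma gen_idealZ (K : comNzRingType) (A : algType K) (X : A -> Prop) c x :
  x \in gen_ideal X -> c *: x \in gen_ideal X.
Proof. by move=> Xx; rewrite -mulr_algl; apply: gen_ideal_mull. Qed.

(** * Auxiliary sums, matrix products and linear combinations *)

Lemma sum_pointed (V : nmodType) (T : finType) (a : T) (P : pred T)
    (G : T -> V) :
    (forall i, i != a -> G i = 0) ->
  \sum_(i | P i) G i = if P a then G a else 0.
Proof.
move=> G0; rewrite big_mkcond (bigD1 a) //= big1 ?addr0 // => i ia.
by rewrite G0 // if_same.
Qed.

(* [tensmx_mul] is only available over commutative rings. *)
Lemma tensmx1_mul_1tensmx (R : pzRingType) (n : nat) (M N : 'M[R]_n) a b c d :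
  (M *t (1%:M : 'M_n) *m ((1%:M : 'M_n) *t N))
    (mxtens_index (a, b)) (mxtens_index (c, d)) = M a c * N b d.
Proof.
rewrite mxE (bigD1 (mxtens_index (c, b))) //= big1 => [|k].
  by rewrite !tensmxE !mxE !eqxx mulr1 mul1r addr0.
case: (mxtens_indexP k) => e f; rewrite (can_eq (@mxtens_indexK _ _)) xpair_eqE.
rewrite !tensmxE !mxE [b == f]eq_sym.
by case: (e == c) => [/= /negPf->|_]; rewrite ?mulr0 !mul0r ?mulr0.
Qed.

Lemma lfunDZ (K : fieldType) (U V : vectType K) (f : 'Hom(U, V)) a b u v :
  f (a *: u + b *: v) = a *: f u + b *: f v.
Proof. by rewrite linearD !linearZ. Qed.

Lemma sub_lfunE (K : fieldType) (U V : vectType K) (f g : 'Hom(U, V)) u :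
  (f - g) u = f u - g u.
Proof. by rewrite add_lfunE opp_lfunE. Qed.

Lemma linear_comb3 (K : fieldType) (U V : lmodType K) (f : {linear U -> V})
    a b c u v w u' v' w' :
    f u = u' -> f v = v' -> f w = w' ->
  f (a *: u + b *: v - c *: w) = a *: u' + b *: v' - c *: w'.
Proof. by move=> <- <- <-; rewrite linearB linearD !linearZ. Qed.

Lemma sub_scale_comb (K : fieldType) (U : lmodType K) (m : K)
    (x y x' z h h' s t : K) (u v w : U) :
    x - x' = m * (h - h') -> y = m * s -> z = m * t ->
  x *: u + y *: v - (x' *: u + z *: w) =
  m *: ((h - h') *: u + s *: v - t *: w).
Proof.
move=> mx -> ->; rewrite scalerBr scalerDr !scalerA -mx scalerBl opprD !addrA.
by congr (_ - _); rewrite addrAC.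
Qed.

(** * Involutions and commuting endomorphisms *)

Section LinearPairs.
Variables (K : fieldType) (U : vectType K).

(** The two scalar conditions are the first row of the square of the 2 by 2 matrix of [f]. The case
    [x = y] is included; it occurs for equal indices. *)
Lemma invol_pair (f : 'End(U)) (x y : U) (a b a' b' : K) :
    f x = a *: x + b *: y -> f y = a' *: y + b' *: x ->
    a * a + b * b' = 1 -> a * b + b * a' = 0 ->
  f (f x) = x.
Proof.
move=> fx fy aabb abba; rewrite fx lfunDZ fx fy !scalerDr !scalerA.
rewrite [X in _ + X]addrC addrACA -!scalerDl aabb abba.
by rewrite scale1r scale0r addr0.
Qed.

(** The vectors are the corners of a square: [f] acts along one direction and [g] along the other,
    each with the same coefficients on parallel edges. *)
Lemma comm_square (f g : 'End(U)) (x y z w : U) (a b c d : K) :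
    f x = a *: x + b *: z -> f y = a *: y + b *: w ->
    g x = c *: x + d *: y -> g z = c *: z + d *: w ->
  f (g x) = g (f x).
Proof.
move=> fx fy gx gz; rewrite gx fx !lfunDZ fx fy gx gz !scalerDr !scalerA.
by rewrite addrACA !(mulrC c, mulrC d).
Qed.

Lemma comm_invol_skewP (f g t : 'End(U)) (u : U) :
    (2%:R : K) != 0 -> involutive f -> involutive g ->
    (forall v, f (g v) = g (f v)) -> (forall v, g (f v) = t v) ->
  t u = - u <-> exists w, u = g w - f w.
Proof.
move=> two_neq0 ff gg fg gft; split=> [tu|[w ->]]; last first.
  by rewrite -gft [f _]linearB /= ff fg linearB /= gg opprB.
have fu : f u = - g u by rewrite -[LHS]gg gft tu linearN.
(* Since [f u = - g u], this [w] satisfies [g w = u / 2] and [f w = - u / 2]. *)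
exists (2%:R^-1 *: g u).
rewrite !linearZ /= gg fg fu [g (- _)]linearN /= gg opprK -scalerDl.
by rewrite -mulr2n -[_ *+ 2]mulr_natl divff // scale1r.
Qed.

End LinearPairs.

(** * Linear maps computed on basis vectors *)

Section Coordinates.
Variable K : fieldType.
Local Notation bv := (bv K).

Lemma vec_sum_bv (B : finType) (v : vec K B) : v = \sum_b v b *: bv b.
Proof.
apply/ffunP => c; rewrite sum_ffunE (bigD1 c) //= big1 => [|b /negPf bc].
  by rewrite !ffunE eqxx addr0 [RHS]mulr1.
by rewrite !ffunE eq_sym bc [LHS]mulr0.
Qed.

Lemma hom_bv_ext (B C : finType) (f g : 'Hom(vec K B, vec K C)) :
  (forall b, f (bv b) = g (bv b)) -> f = g.
Proof.
move=> fg; apply/lfunP=> v; rewrite [v]vec_sum_bv !linear_sum.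
by apply: eq_bigr => b _; rewrite !linearZ /= fg.
Qed.

Lemma comp_bv_ext (B C D E : finType) (f : 'Hom(vec K C, vec K D))
    (g : 'Hom(vec K B, vec K C)) (f' : 'Hom(vec K E, vec K D))
    (g' : 'Hom(vec K B, vec K E)) :
  (forall b, f (g (bv b)) = f' (g' (bv b))) -> forall u, f (g u) = f' (g' u).
Proof.
move=> fg u; rewrite -!comp_lfunE; congr (fun_of_lfun _ u).
by apply: hom_bv_ext => b; rewrite !comp_lfunE.
Qed.

Lemma invol_bv_ext (B : finType) (f : 'End(vec K B)) :
  (forall b, f (f (bv b)) = bv b) -> involutive f.
Proof.
move=> ff u; rewrite -comp_lfunE -[RHS]id_lfunE; congr (fun_of_lfun _ u).
by apply: hom_bv_ext => b; rewrite comp_lfunE id_lfunE.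
Qed.

Lemma tens_bv (B C : finType) (b : B) (c : C) :
  tens (bv b) (bv c) = bv (b, c).
Proof. by apply/ffunP=> -[x y]; rewrite !ffunE xpair_eqE -natrM mulnb. Qed.

Lemma flip_bv (B C : finType) (b : B) (c : C) :
  flip K B C (bv (b, c)) = bv (c, b).
Proof. by rewrite linextE tens_bv. Qed.

(** The inverse of a linear map is a total operation; it is a left inverse because the kernel is
    zero, and composing it with [flipK] identifies it. *)
Lemma flip_inv (B C : finType) : (flip K B C)^-1%VF = flip K C B.
Proof.
have flipK (X Y : finType) : (flip K X Y \o flip K Y X = \1)%VF.
  by apply: hom_bv_ext => -[y x]; rewrite comp_lfunE !flip_bv id_lfunE.
have ker0 : lker (flip K B C) == 0%VS.
  apply/lker0P; apply: (@can_inj _ _ _ (flip K C B)) => u.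
  by rewrite -comp_lfunE flipK id_lfunE.
rewrite -[LHS]comp_lfun1r -(flipK B C) comp_lfunA lker0_compVf //.
exact: comp_lfun1l.
Qed.

Lemma id_tens_id_flip_bv (A B C D : finType) (a : A) (b : B) (c : C) (d : D) :
  id_tens_id A D (flip K B C) (bv ((a, b), (c, d))) = bv ((a, c), (b, d)).
Proof.
rewrite linextE; apply/ffunP=> -[[a' c'] [b' d']].
by rewrite flip_bv !ffunE /= -!natrM !mulnb !xpair_eqE !andbA.
Qed.

Lemma tensDZ (B C : finType) (a b c d : K) (u v : vec K B) (x y : vec K C) :
  tens (a *: u + b *: v) (c *: x + d *: y) =
  a *: (c *: tens u x + d *: tens u y) + b *: (c *: tens v x + d *: tens v y).
Proof. by apply/ffunP=> p; rewrite !ffunE /GRing.scale /=; ring. Qed.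

Fact deg2_linear (B : finType) : linear (@deg2 K B).
Proof.
move=> a u v; rewrite /deg2 scaler_sumr -big_split /=.
by apply: eq_bigr => p _; rewrite !ffunE scalerDl scalerA.
Qed.

HB.instance Definition _ (B : finType) :=
  GRing.isLinear.Build K (vec K (B * B)%type) (free_alg K B) *:%R (@deg2 K B)
    (@deg2_linear B).

Lemma deg2_bv (B : finType) (b c : B) : deg2 (bv (b, c)) = gen K b * gen K c.
Proof. by rewrite -tens_bv deg2_tens !deg1_bv. Qed.

Lemma deg2_lfun_sum (B C : finType)
    (f : 'Hom(vec K B, vec K (C * C)%type)) (w : vec K B) :
  deg2 (f w) = \sum_b (w b : K) *: deg2 (f (bv b)).
Proof.
rewrite {1}[w]vec_sum_bv !linear_sum; apply: eq_bigr => b _.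
by rewrite !linearZ.
Qed.

Lemma leigenspaceP (B : finType) (f : 'End(vec K B)) a u :
  reflect (f u = a *: u) (u \in passmx.leigenspace f a).
Proof. by apply: (iffP eqlfunP); rewrite scale_lfunE id_lfunE. Qed.

End Coordinates.

(** * The two commuting involutions whose product is [tau_FRT] *)

Section FRT.
Variables (K : fieldType) (q : K) (n : nat).
Local Notation I2 := ('I_n * 'I_n)%type.
Local Notation W2 := (vec K (I2 * I2)%type).
Local Notation bv := (bv K).

(** The values 1 and 0 of [tau_diag] and [tau_swap] at equal indices let a single two-term formula
    describe [tau_basis] in all cases. *)
Definition tau_diag (i j : 'I_n) : K :=
  if i == j then 1
  else (Num.sg (i%:Z - j%:Z))%:~R * ((1 - q ^+ 2) / (1 + q ^+ 2)).

Definition tau_swap (i j : 'I_n) : K :=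
  if i == j then 0 else 2%:R * q / (1 + q ^+ 2).

Lemma tau_basisE i j :
  tau_basis q (i, j) = tau_diag i j *: bv (i, j) + tau_swap i j *: bv (j, i).
Proof.
rewrite /tau_basis /tau_diag /tau_swap.
by case: eqP => _; rewrite !tens_bv // scale1r scale0r addr0.
Qed.

(* The basis vector ((i, j), (k, l)) is e_i (x) f^j (x) e_k (x) f^l, so tau acts
   on the indices i, k for the V-factors and on j, l for the V^*-factors. *)
Definition tau_left : 'End(W2) := linext (fun p : I2 * I2 =>
  tau_diag p.1.1 p.2.1 *: bv p
  + tau_swap p.1.1 p.2.1 *: bv ((p.2.1, p.1.2), (p.1.1, p.2.2))).

Definition tau_right : 'End(W2) := linext (fun p : I2 * I2 =>
  tau_diag p.1.2 p.2.2 *: bv p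
  + tau_swap p.1.2 p.2.2 *: bv ((p.1.1, p.2.2), (p.2.1, p.1.2))).

Lemma tau_left_bv i j k l : tau_left (bv ((i, j), (k, l))) =
  tau_diag i k *: bv ((i, j), (k, l)) + tau_swap i k *: bv ((k, j), (i, l)).
Proof. by rewrite linextE. Qed.

Lemma tau_right_bv i j k l : tau_right (bv ((i, j), (k, l))) =
  tau_diag j l *: bv ((i, j), (k, l)) + tau_swap j l *: bv ((i, l), (k, j)).
Proof. by rewrite linextE. Qed.

Lemma tau_FRT_bv i j k l : tau_FRT q n (bv ((i, j), (k, l))) =
  tau_diag i k *: (tau_diag j l *: bv ((i, j), (k, l))
                   + tau_swap j l *: bv ((i, l), (k, j)))
  + tau_swap i k *: (tau_diag j l *: bv ((k, j), (i, l))
                     + tau_swap j l *: bv ((k, l), (i, j))).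
Proof.
rewrite /tau_FRT /sigma_VVdual flip_inv comp_lfunE comp_lfunE.
rewrite id_tens_id_flip_bv /tens_map linextE /tau_VV /tau_dualVV !linextE.
rewrite !tau_basisE tensDZ !tens_bv lfunDZ.
by congr (_ *: _ + _ *: _); rewrite lfunDZ; congr (_ *: _ + _ *: _);
  rewrite id_tens_id_flip_bv.
Qed.

Lemma tau_right_left u : tau_right (tau_left u) = tau_FRT q n u.
Proof.
rewrite -comp_lfunE; congr (fun_of_lfun _ u).
apply: hom_bv_ext => -[[i j] [k l]].
rewrite comp_lfunE tau_FRT_bv [X in tau_right X]tau_left_bv lfunDZ.
by congr (_ *: _ + _ *: _); rewrite tau_right_bv.
Qed.

(** The two operators permute disjoint pairs of indices, and the coefficients of each depend only on
    its own pair. *)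
Lemma tau_left_right u : tau_left (tau_right u) = tau_right (tau_left u).
Proof.
apply: comp_bv_ext => -[[i j] [k l]].
exact: comm_square (tau_left_bv i j k l) (tau_left_bv i l k j)
                   (tau_right_bv i j k l) (tau_right_bv k j i l).
Qed.

Hypothesis q2D1 : 1 + q ^+ 2 != 0.

(** For distinct indices this is the identity [(1 - q^2)^2 + (2 q)^2 = (1 + q^2)^2], the sign having
    square 1. *)
Lemma tau_diag_swap2 i j :
  tau_diag i j * tau_diag i j + tau_swap i j * tau_swap j i = 1.
Proof.
rewrite /tau_diag /tau_swap [j == i]eq_sym.
have [_|ij] := eqVneq i j; first by rewrite mulr0 addr0 mulr1.
rewrite mulrACA -intrM -expr2 sqr_sg subr_eq0 eqz_nat val_eqE ij mul1r.
by field.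
Qed.

(** [tau_swap] is symmetric, while off the diagonal [tau_diag] is antisymmetric through its sign. *)
Lemma tau_diag_swap i j :
  tau_diag i j * tau_swap i j + tau_swap i j * tau_diag j i = 0.
Proof.
rewrite /tau_diag /tau_swap [j == i]eq_sym.
have [_|_] := eqVneq i j; first by rewrite mulr0 mul0r addr0.
by rewrite -opprB sgrN rmorphN; ring.
Qed.

Lemma tau_left_invol : involutive tau_left.
Proof.
apply: invol_bv_ext => -[[i j] [k l]].
exact: invol_pair (tau_left_bv i j k l) (tau_left_bv k j i l)
                  (tau_diag_swap2 i k) (tau_diag_swap i k).
Qed.

Lemma tau_right_invol : involutive tau_right.
Proof.
apply: invol_bv_ext => -[[i j] [k l]].
exact: invol_pair (tau_right_bv i j k l) (tau_right_bv i l k j)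
                  (tau_diag_swap2 j l) (tau_diag_swap j l).
Qed.

Lemma tau_FRT_skewP (u : W2) : (2%:R : K) != 0 ->
  tau_FRT q n u = - u <-> exists w, u = tau_right w - tau_left w.
Proof.
move=> two_neq0.
exact: comm_invol_skewP two_neq0 tau_left_invol tau_right_invol
  tau_left_right tau_right_left.
Qed.

(** * Entries of the Hecke matrix and the FRT relations *)

Definition hecke_diag (a b : 'I_n) : K :=
  if a == b then q else if (a < b)%N then q - q^-1 else 0.

(** In each of the three sums defining [hecke_mx] at most one term meets row [(a, b)], so this row
    is supported in the columns [(a, b)] and [(b, a)]. *)
Lemma hecke_mxE a b c d :
  hecke_mx q n (mxtens_index (a, b)) (mxtens_index (c, d)) =
  hecke_diag a b * ((c, d) == (a, b))%:R + (a != b)%:R * ((c, d) == (b, a))%:R.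
Proof.
pose E i j : 'M[K]_n := delta_mx i j.
have ent i j k l :
    (E i j *t E k l) (mxtens_index (a, b)) (mxtens_index (c, d)) =
    ((a == i) && (c == j))%:R * ((b == k) && (d == l))%:R.
  by rewrite tensmxE !mxE.
have S1 : (\sum_i E i i *t E i i) (mxtens_index (a, b)) (mxtens_index (c, d)) =
    (c == a)%:R * ((b == a) && (d == a))%:R.
  rewrite summxE (@sum_pointed _ _ a) => [|i ia]; first by rewrite ent eqxx.
  by rewrite ent eq_sym (negPf ia) mul0r.
have S2 : (\sum_i \sum_(j | j != i) E i j *t E j i)
    (mxtens_index (a, b)) (mxtens_index (c, d)) =
    if b != a then (c == b)%:R * (d == a)%:R else 0.
  rewrite summxE (@sum_pointed _ _ a) => [|i ia]; last first.
    by rewrite summxE big1 // => j _; rewrite ent eq_sym (negPf ia) mul0r.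
  rewrite summxE (@sum_pointed _ _ b) => [|j jb]; first by rewrite ent !eqxx.
  by rewrite ent [b == j]eq_sym (negPf jb) mulr0.
have S3 : (\sum_(i < n) \sum_(k < n | (i < k)%N) E i i *t E k k)
    (mxtens_index (a, b)) (mxtens_index (c, d)) =
    if (a < b)%N then (c == a)%:R * (d == b)%:R else 0.
  rewrite summxE (@sum_pointed _ _ a) => [|i ia]; last first.
    by rewrite summxE big1 // => j _; rewrite ent eq_sym (negPf ia) mul0r.
  rewrite summxE (@sum_pointed _ _ b) => [|j jb]; first by rewrite ent !eqxx.
  by rewrite ent [b == j]eq_sym (negPf jb) mulr0.
rewrite /hecke_mx mxE [X in X + _]mxE [X in X + _ + _]mxE [X in _ + X]mxE.
rewrite S1 S2 S3 !xpair_eqE -!natrM !mulnb /hecke_diag [b == a]eq_sym.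
have [<-|ab] /= := eqVneq a b; first by rewrite ltnn; ring.
by case: ifP => _; rewrite ?andbF /=; ring.
Qed.

(** Symmetry allows right multiplication by S to be computed with the row formula [hecke_mx_sum], as
    left multiplication is. *)
Lemma hecke_mx_sym r s : hecke_mx q n r s = hecke_mx q n s r.
Proof.
case: (mxtens_indexP r) => a b; case: (mxtens_indexP s) => c d.
rewrite !hecke_mxE.
have -> : ((a, b) == (d, c)) = ((c, d) == (b, a)).
  by rewrite !xpair_eqE andbC (eq_sym a) (eq_sym b).
have [[-> ->] //|_] := eqVneq (c, d) (a, b).
by have [[-> ->]|_] := eqVneq (c, d) (b, a); rewrite ?mulr0 // eq_sym.
Qed.

Lemma hecke_mx_sum (U : lmodType K) (f : 'I_(n * n) -> U) a b :
  \sum_k hecke_mx q n (mxtens_index (a, b)) k *: f k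
  = hecke_diag a b *: f (mxtens_index (a, b))
    + (a != b)%:R *: f (mxtens_index (b, a)).
Proof.
have sum1 e z : \sum_k (e * (mxtens_unindex k == z)%:R) *: f k =
    e *: f (mxtens_index z).
  rewrite (bigD1 (mxtens_index z)) //= mxtens_indexK eqxx mulr1 big1 ?addr0 //.
  move=> k kz; rewrite -(can_eq (@mxtens_indexK _ _)) mxtens_unindexK.
  by rewrite (negPf kz) mulr0 scale0r.
rewrite -!sum1 -big_split; apply: eq_bigr => k _ /=; rewrite -scalerDl.
by case: (mxtens_indexP k) => c d; rewrite hecke_mxE mxtens_indexK.
Qed.

(** The transposition comes from pairing [T^i_j] with [e^j_i]. Rows of T thus carry the [V^*]
    indices and columns the V indices, so S on the left acts on [V^*] and S on the right on V. *)
Lemma frt_mxE i j : frt_mx K n i j = gen K (j, i).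
Proof.
rewrite /frt_mx summxE (bigD1 j) //= [X in _ + X]big1 => [|k kj]; last first.
  rewrite summxE big1 // => l _.
  by rewrite !mxE [j == k]eq_sym (negPf kj) andbF mulr0.
rewrite summxE (bigD1 i) //= big1 => [|l li]; last first.
  by rewrite !mxE [i == l]eq_sym (negPf li) mulr0.
by rewrite !mxE !eqxx mulr1 !addr0.
Qed.

Lemma hecke_mx_rttE (A : algType K) (M : 'M[A]_n) a b c d :
  let S := map_mx (fun x : K => x%:A : A) (hecke_mx q n) in
  let T1 := M *t (1%:M : 'M[A]_n) in
  let T2 := (1%:M : 'M[A]_n) *t M in
  (S *m T1 *m T2 - T1 *m T2 *m S) (mxtens_index (a, b)) (mxtens_index (c, d)) =
  (hecke_diag a b - hecke_diag c d) *: (M a c * M b d)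
  + (a != b)%:R *: (M b c * M a d) - (c != d)%:R *: (M a d * M b c).
Proof.
move=> S T1 T2; rewrite -mulmxA.
have XE i j k l : (T1 *m T2) (mxtens_index (i, j)) (mxtens_index (k, l)) =
    M i k * M j l by exact: tensmx1_mul_1tensmx.
move: (T1 *m T2) XE => X XE; rewrite 2!mxE.
under eq_bigr do rewrite [S _ _]mxE mulr_algl.
rewrite [X in _ + X]mxE [X in _ - X]mxE.
(* The entries of S are scalars, hence central, and symmetry turns its column into a row. *)
under [X in _ - X]eq_bigr do rewrite [S _ _]mxE mulr_algr hecke_mx_sym.
rewrite (hecke_mx_sum (fun k => X k _)) (hecke_mx_sum (fun k => X _ k)) !XE.
by rewrite scalerBl opprD !addrA; congr (_ - _); rewrite addrAC.
Qed.

Lemma frt_relE a b c d :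
  frt_rel q n (mxtens_index (a, b)) (mxtens_index (c, d)) =
  deg2 ((hecke_diag a b - hecke_diag c d) *: bv ((c, a), (d, b))
        + (a != b)%:R *: bv ((c, b), (d, a))
        - (c != d)%:R *: bv ((d, a), (c, b))).
Proof.
have frtM i j k l :
    frt_mx K n i k * frt_mx K n j l = deg2 (bv ((k, i), (l, j))).
  rewrite [RHS]deg2_bv.
  exact: (f_equal2 *%R (frt_mxE i k) (frt_mxE j l)).
apply: etrans (hecke_mx_rttE (frt_mx K n) a b c d) _.
apply/esym.
apply: linear_comb3; apply/esym; exact: frtM.
Qed.

(** * Comparison of the generators and equality of the ideals *)

Hypotheses (q_neq0 : q != 0) (two_neq0 : (2%:R : K) != 0).

(** This is [2 / (q + q^-1)], the factor of S in the expression of tau through S. *)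
Let mu : K := 2%:R * q / (1 + q ^+ 2).

Lemma mu_neq0 : mu != 0.
Proof. by rewrite !mulf_neq0 ?invr_neq0. Qed.

(** The additive constant does not depend on the indices, so it cancels in
    [tau_right - tau_left]. *)
Lemma tau_diag_hecke a b :
  tau_diag a b = mu * hecke_diag a b + (1 - q ^+ 2) / (1 + q ^+ 2).
Proof.
rewrite /tau_diag /hecke_diag /mu.
have [_|ab] := eqVneq a b; first by field.
case: (ltngtP a b) => [lt_ab|lt_ab|/val_inj eq_ab].
- rewrite ltr0_sg ?subr_lt0 ?ltz_nat // rmorphN1.
  by field; rewrite q_neq0 q2D1.
- by rewrite gtr0_sg ?subr_gt0 ?ltz_nat // rmorph1; field.
- by rewrite eq_ab eqxx in ab.
Qed.

Lemma tau_swap_hecke a b : tau_swap a b = mu * (a != b)%:R.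
Proof. by rewrite /tau_swap; case: eqP => _; rewrite ?mulr0 ?mulr1. Qed.

Lemma deg2_tau_bv a b c d :
  deg2 ((tau_right - tau_left) (bv ((c, a), (d, b)))) =
  mu *: frt_rel q n (mxtens_index (a, b)) (mxtens_index (c, d)).
Proof.
rewrite frt_relE -[RHS]linearZ sub_lfunE; congr deg2.
apply: etrans (f_equal2 (fun u v => u - v) (tau_right_bv c a d b)
                                           (tau_left_bv c a d b)) _.
apply: sub_scale_comb; last 2 first.
- exact: tau_swap_hecke.
- exact: tau_swap_hecke.
by rewrite !tau_diag_hecke; ring.
Qed.

Lemma skew_idealE : @skew_ideal K q n =i @frt_ideal K q n.
Proof.
move=> x; apply/idP/idP; apply: gen_ideal_sub => {}x.
  case=> u /leigenspaceP; rewrite scaleN1r.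
  move=> /(tau_FRT_skewP _ two_neq0)[w ->] ->.
  (* Expanding [w] in the basis writes the generator as a combination of entries of [frt_rel]. *)
  rewrite -sub_lfunE deg2_lfun_sum; apply: rpred_sum => -[[c a] [d b]] _.
  rewrite deg2_tau_bv; do 2!apply: gen_idealZ; apply: mem_gen_ideal.
  by exists (mxtens_index (a, b)), (mxtens_index (c, d)).
case=> r [s ->]; case: (mxtens_indexP r) => a b; case: (mxtens_indexP s) => c d.
(* As [mu] is invertible, the relation is a multiple of the image of one basis vector under
   [tau_right - tau_left], which is skew. *)
rewrite -[frt_rel _ _ _ _](scalerK mu_neq0) -deg2_tau_bv.
apply: gen_idealZ; apply: mem_gen_ideal.
exists ((tau_right - tau_left) (bv ((c, a), (d, b)))) => //.
apply/leigenspaceP; rewrite scaleN1r; apply/(tau_FRT_skewP _ two_neq0).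
by exists (bv ((c, a), (d, b))); rewrite sub_lfunE.
Qed.

Lemma T_mod_skew_iso :
  exists f : {lrmorphism T_mod_skew q n -> A_FRT q n}, bijective f.
Proof. exact: (bquot_iso skew_idealE). Qed.

End FRT.

Theorem theorem5p1 (R : realType) (n : nat) :
  exists f : {lrmorphism T_mod_skew (qvar R) n -> A_FRT (qvar R) n},
    bijective f.
Proof.
have X_neq0 : ('X : {poly R[i]}) != 0 by rewrite polyX_eq0.
have q_neq0 : qvar R != 0 by rewrite tofrac_eq0.
have q2D1 : 1 + qvar R ^+ 2 != 0.
  (* The polynomial [X^2 + 1] has size 3, so its image in the fraction field is nonzero. *)
  rewrite -tofrac1 -tofracXn -tofracD tofrac_eq0 addrC -size_poly_eq0.
  by rewrite size_polyDl size_polyXn ?size_poly1.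
have two_neq0 : (2%:R : ratfun R) != 0.
  rewrite -tofrac1 -tofracMn tofrac_eq0 -polyC1 -polyCMn polyC_eq0.
  by rewrite pnatr_eq0.
exact: (T_mod_skew_iso n q2D1 q_neq0 two_neq0).
Qed.
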